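(* Let $A$ be an Archimedean semiprime $f$-algebra and let $B$ be a subalgebra of $A$. Then the Riesz subspace $\mathcal{R}(B)$ of $A$ generated by $B$ is an $f$-subalgebra of $A$ (that is, $\mathcal{R}(B)$ is both a Riesz subspace and a subalgebra of $A$).
   Context: A Riesz space is a real vector lattice. A lattice-ordered algebra is a Riesz space $A$ with an associative (bilinear) multiplication such that $fg\ge 0$ for all $f,g\in A^{+}$. It is an $f$-algebra if $f\wedge g=0$ and $0\le h\in A$ imply $fh\wedge g=hf\wedge g=0$. No unit element is assumed. An $f$-algebra is semiprime if it has no nonzero nilpotent elements. A subalgebra is a vector subspace closed under multiplication (not assumed to be a sublattice). For a subset $D$ of a Riesz space, $\mathcal{R}(D)$ denotes the smallest Riesz subspace (vector sublattice) containing $D$. *)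

(* Defs.v *)
From HB Require Import structures.
From mathcomp Require Import all_boot all_order ssralg orderedzmod.
From mathcomp Require Import classical_sets reals.

(* Pitfall: importing all_algebra (or numdomain) before the structures below
   makes Hierarchy-Builder reject them, since realDomainType already combines
   zmodType and latticeType with no common substructure declared for this
   combination. Importing all_algebra after this file is harmless. *)

Set Implicit Arguments.
Unset Strict Implicit.
Unset Printing Implicit Defensive.

Import GRing.Theory.
Local Open Scope classical_set_scope.
Local Open Scope ring_scope.

HB.mixin Record Lattice_Lmodule_isRiesz (R : realType) V
    of Order.Lattice ring_display V & GRing.Lmodule R V := {
  riesz_leD2r : forall z x y : V, x <= y -> x + z <= y + z;
  riesz_scale_ge0 : forall (a : R) (x : V), 0 <= a -> 0 <= x -> 0 <= a *: x
}.

#[short(type="rieszSpaceType")]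
HB.structure Definition RieszSpace (R : realType) :=
  { V of Lattice_Lmodule_isRiesz R V
       & Order.Lattice ring_display V & GRing.Lmodule R V }.

(* MathComp's rings are unital, so the multiplication is that of a semigroup;
   it is written in group_scope, but there is no unit and no inverse. *)
HB.mixin Record Riesz_Semigroup_isLatticeAlgebra (R : realType) A
    of RieszSpace R A & Semigroup A := {
  lalg_mulDl : forall x y z : A, ((x + y)%R * z)%g = (x * z)%g + (y * z)%g;
  lalg_mulDr : forall x y z : A, (x * (y + z)%R)%g = (x * y)%g + (x * z)%g;
  lalg_scaleAl : forall (a : R) (x y : A), ((a *: x)%R * y)%g = a *: (x * y)%g;
  lalg_scaleAr : forall (a : R) (x y : A), (x * (a *: y)%R)%g = a *: (x * y)%g;
  lalg_mul_ge0 : forall x y : A, 0 <= x -> 0 <= y -> 0 <= (x * y)%g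
}.

#[short(type="latticeAlgebraType")]
HB.structure Definition LatticeAlgebra (R : realType) :=
  { A of Riesz_Semigroup_isLatticeAlgebra R A & RieszSpace R A & Semigroup A }.

HB.mixin Record LatticeAlgebra_isFAlgebra (R : realType) A
    of LatticeAlgebra R A := {
  falg_meet0 : forall f g h : A, (f `&` g)%O = 0 -> 0 <= h ->
    ((f * h)%g `&` g)%O = 0 /\ ((h * f)%g `&` g)%O = 0
}.

#[short(type="fAlgebraType")]
HB.structure Definition FAlgebra (R : realType) :=
  { A of LatticeAlgebra_isFAlgebra R A & LatticeAlgebra R A }.

Definition archimedean_riesz (R : realType) (V : rieszSpaceType R) : Prop :=
  forall x y : V, 0 <= x -> (forall n : nat, x *+ n <= y) -> x = 0.

(* In the absence of a unit, iter n ( *%g x ) x is the power x^(n+1). *)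
Definition nilpotent_elt (R : realType) (A : latticeAlgebraType R) (x : A) :
    Prop :=
  exists n : nat, iter n ( *%g x ) x = 0.

Definition semiprime (R : realType) (A : latticeAlgebraType R) : Prop :=
  forall x : A, nilpotent_elt x -> x = 0.

Definition subalgebra (R : realType) (A : latticeAlgebraType R) (B : set A) :
    Prop :=
  submod_closed (mem B) /\ mulg_closed (mem B).

Definition riesz_subspace (R : realType) (V : rieszSpaceType R) (E : set V) :
    Prop :=
  submod_closed (mem E) /\
  (forall x y : V, E x -> E y -> E (x `&` y)%O /\ E (x `|` y)%O).

Definition riesz_generated (R : realType) (V : rieszSpaceType R) (D : set V) :
    set V :=
  smallest (@riesz_subspace R V) D.

Definition f_subalgebra (R : realType) (A : fAlgebraType R) (B : set A) :
    Prop :=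
  riesz_subspace B /\ subalgebra B.

(* Main.v *)
Require Import Defs.
From HB Require Import structures.
From mathcomp Require Import all_boot all_order all_algebra.
From mathcomp Require Import classical_sets reals.

(* Multiplication by a positive element of an f-algebra is a lattice
   homomorphism. The lattice generated by the subalgebra B is already a Riesz
   subspace, so R(B) consists of the lattice polynomials in elements of B, and
   products of positive parts of such elements reduce to the products x^+ y^+
   with x and y in B. These are in R(B) by the Henriksen-Isbell type identity
   x^+ y^+ = 0 \/ (xy /\ (y + x^2 y)). *)

Set Implicit Arguments.
Unset Strict Implicit.
Unset Printing Implicit Defensive.

Import Order.TTheory GRing.Theory.
Local Open Scope classical_set_scope.
Local Open Scope ring_scope.

(** * Order and lattice arithmetic in Riesz spaces *)

Section RieszSpace.
Variables (R : realType) (V : rieszSpaceType R).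
Implicit Types (x y z a b c : V) (D E : set V).

Lemma riesz_leD2rE z x y : (x + z <= y + z) = (x <= y).
Proof.
apply/idP/idP => [h|]; last exact: riesz_leD2r.
by have := @riesz_leD2r _ _ (- z) _ _ h; rewrite !addrK.
Qed.

Lemma riesz_leBlDr x y z : (x - y <= z) = (x <= z + y).
Proof. by rewrite -(riesz_leD2rE y (x - y)) subrK. Qed.

Lemma riesz_leBrDr x y z : (x <= y - z) = (x + z <= y).
Proof. by rewrite -(riesz_leD2rE z x) subrK. Qed.

Lemma riesz_subr_ge0 x y : (0 <= y - x) = (x <= y).
Proof. by rewrite riesz_leBrDr add0r. Qed.

Lemma riesz_leD x y z t : x <= y -> z <= t -> x + z <= y + t.
Proof.
move=> xy zt; apply: (@le_trans _ _ (y + z)); first by rewrite riesz_leD2rE.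
by rewrite ![y + _]addrC riesz_leD2rE.
Qed.

Lemma riesz_addr_ge0 x y : 0 <= x -> 0 <= y -> 0 <= x + y.
Proof. by move=> x0 y0; rewrite -[0]addr0 riesz_leD. Qed.

Lemma riesz_leDl x y : 0 <= y -> x <= x + y.
Proof. by move=> y0; rewrite -{1}[x]addr0 riesz_leD. Qed.

Lemma riesz_leDr x y : 0 <= y -> x <= y + x.
Proof. by rewrite addrC; exact: riesz_leDl. Qed.

Lemma riesz_leN2 x y : (- x <= - y) = (y <= x).
Proof. by rewrite -(riesz_leD2rE (x + y) (- x)) addKr addrC addrK. Qed.

Lemma riesz_leZ (k : R) x y : 0 <= k -> x <= y -> k *: x <= k *: y.
Proof.
move=> k0 xy; rewrite -riesz_subr_ge0 -scalerBr.
by apply: riesz_scale_ge0; rewrite ?riesz_subr_ge0.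
Qed.

Lemma riesz_meetDl z x y : (x `&` y)%O + z = ((x + z) `&` (y + z))%O.
Proof.
apply/le_anti/andP; split.
  by rewrite lexI !riesz_leD2rE leIl leIr.
by rewrite -riesz_leBlDr lexI !riesz_leBlDr leIl leIr.
Qed.

Lemma riesz_joinDl z x y : (x `|` y)%O + z = ((x + z) `|` (y + z))%O.
Proof.
apply/le_anti/andP; split.
  by rewrite -riesz_leBrDr leUx !riesz_leBrDr leUl leUr.
by rewrite leUx !riesz_leD2rE leUl leUr.
Qed.

Lemma riesz_oppI x y : - (x `&` y)%O = ((- x) `|` (- y))%O.
Proof.
apply/le_anti/andP; split; last by rewrite leUx !riesz_leN2 leIl leIr.
by rewrite -[X in _ <= X]opprK riesz_leN2 lexI -(riesz_leN2 x) -(riesz_leN2 y)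
  !opprK
  leUl leUr.
Qed.

Lemma riesz_oppU x y : - (x `|` y)%O = ((- x) `&` (- y))%O.
Proof. by rewrite -[RHS]opprK riesz_oppI !opprK. Qed.

Lemma riesz_scaleI (k : R) x y : 0 < k ->
  k *: (x `&` y)%O = ((k *: x) `&` (k *: y))%O.
Proof.
move=> k0; have kn0 : k != 0 by rewrite gt_eqF.
have kV0 : 0 <= k^-1 by rewrite Num.Theory.invr_ge0 ltW.
apply/le_anti/andP; split.
  by rewrite lexI !(riesz_leZ (ltW k0)) ?leIl ?leIr.
rewrite -[X in X <= _]scale1r -(mulfV kn0) -scalerA; apply: riesz_leZ (ltW k0)
  _.
rewrite lexI -{2}[x]scale1r -{3}[y]scale1r -(mulVf kn0) -!scalerA.
by rewrite !(riesz_leZ kV0) ?leIl ?leIr.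
Qed.

Lemma riesz_scaleU (k : R) x y : 0 < k ->
  k *: (x `|` y)%O = ((k *: x) `|` (k *: y))%O.
Proof.
by move=> k0; rewrite -[RHS]opprK riesz_oppU -!scalerN -riesz_scaleI //
  -riesz_oppU scalerN opprK.
Qed.

(** Negation turns the meet into a join of negatives, and translating [- x] and [- y] by [x + y]
    swaps them into [y] and [x]. *)
Lemma riesz_meet_join x y : (x `&` y)%O + (x `|` y)%O = x + y.
Proof.
apply: (addIr (- (x `&` y)%O)); rewrite addrAC subrr add0r riesz_oppI addrC
  riesz_joinDl.
by rewrite addKr [x + y]addrC addKr joinC.
Qed.

Lemma riesz_meetUl x y z : ((x `|` y) `&` z = (x `&` z) `|` (y `&` z))%O.
Proof.
apply/le_anti/andP; split; last first.
  by rewrite leUx !lexI !leIr !leIxl ?leUl ?leUr.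
set t := (X in X <= _); set w := (X in _ <= X).
(* For [u] equal to [x] or [y], write [u + t] as meet plus join: the meet of [u] and [t] lies below
   that of [u] and [z], hence below [w], and the join lies below that of [x] and [y]. Joining both
   bounds and cancelling gives [t <= w]. *)
have le_w u : (u `&` z <= w)%O -> (u <= x `|` y)%O -> u <= w - t + (x `|` y)%O.
  move=> uw uxy; rewrite addrAC riesz_leBrDr -riesz_meet_join riesz_leD //.
    by apply: le_trans uw; rewrite leI2 // leIr.
  by rewrite leUx uxy leIl.
have : (x `|` y)%O <= w - t + (x `|` y)%O by rewrite leUx !le_w ?leUl ?leUr.
by rewrite -{1}[(x `|` y)%O]add0r riesz_leD2rE riesz_subr_ge0.
Qed.

Lemma riesz_joinIl x y z : ((x `&` y) `|` z = (x `|` z) `&` (y `|` z))%O.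
Proof.
have zyz : (z `&` (y `|` z))%O = z by apply/meet_idPl; exact: leUr.
have zxz : (z `&` x `|` z)%O = z by apply/join_idPr; exact: leIl.
by rewrite riesz_meetUl zyz [(x `&` (_ `|` _))%O]meetC riesz_meetUl -joinA zxz
  meetC.
Qed.

Lemma riesz_disjointD a b c :
  (a `&` c)%O = 0 -> (b `&` c)%O = 0 -> ((a + b) `&` c)%O = 0.
Proof.
move=> ac bc.
have a0 : 0 <= a by rewrite -ac leIl.
have b0 : 0 <= b by rewrite -bc leIl.
have c0 : 0 <= c by rewrite -bc leIr.
apply/le_anti/andP; split; last by rewrite lexI riesz_addr_ge0.
(* It suffices that the meet is at most [b]: after subtracting [b] it lies below both [a] and [c],
   whose meet is 0. *)
rewrite -[X in _ <= X]bc lexI leIr andbT -[X in _ <= X]add0r -riesz_leBlDr.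
by rewrite -ac lexI !riesz_leBlDr leIl (le_trans (leIr _ _)) ?riesz_leDl.
Qed.

Lemma riesz_disjointW a b c :
  0 <= a -> a <= b -> (b `&` c)%O = 0 -> (a `&` c)%O = 0.
Proof.
move=> a0 ab bc; apply/le_anti/andP; split; first by rewrite -bc leI2.
by rewrite lexI a0 -bc leIr.
Qed.

Lemma riesz_posB a b : (a `&` b)%O = 0 -> ((a - b) `|` 0)%O = a.
Proof.
by move=> ab; rewrite -(subrr a) -![a - _]addrC -riesz_joinDl -riesz_oppI meetC
  ab oppr0 add0r.
Qed.

Lemma riesz_posE x : x = (x `|` 0)%O - ((- x) `|` 0)%O.
Proof.
rewrite -{2}oppr0 -riesz_oppI opprK; apply/eqP.
by rewrite addrC riesz_meet_join addr0.
Qed.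

Lemma riesz_pos_disjoint x : ((x `|` 0) `&` ((- x) `|` 0))%O = 0.
Proof.
by apply: (addIr (- ((- x) `|` 0)%O)); rewrite riesz_meetDl -riesz_posE subrr
  add0r riesz_oppU opprK oppr0.
Qed.

Lemma riesz_disjoint_subI x y : ((x - (x `&` y)%O) `&` (y - (x `&` y)%O))%O = 0.
Proof. by rewrite -riesz_meetDl subrr. Qed.

(** * Lattice polynomials and the generated Riesz subspace *)

Inductive lattice_closure D : set V :=
| lattice_closure_in x : D x -> lattice_closure D x
| lattice_closureI x y : lattice_closure D x -> lattice_closure D y ->
    lattice_closure D (x `&` y)%O
| lattice_closureU x y : lattice_closure D x -> lattice_closure D y ->
    lattice_closure D (x `|` y)%O.

Lemma submod_closedP D : submod_closed (mem D) <->
  [/\ D 0, forall x y, D x -> D y -> D (x + y)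
     & forall k x, D x -> D (k *: x)].
Proof.
split=> [[D0 DZD]|[D0 DD DZ]].
  have D0' : D 0 by have := D0; rewrite ?inE.
  have H k x y : D x -> D y -> D (k *: x + y).
    by move=> Dx Dy; have := DZD k x y; rewrite !inE; apply.
  split=> // [x y Dx Dy|k x Dx]; first by rewrite -[x]scale1r; exact: H.
  by rewrite -[_ *: _]addr0; exact: H.
split; first by rewrite inE.
by move=> k x y; rewrite !inE => Dx Dy; apply: DD => //; exact: DZ.
Qed.

(** Translations and positive scalings are lattice isomorphisms and negation exchanges meet and
    join, so linear operations can be pushed down to the leaves of a lattice polynomial, where [D]
    absorbs them. *)
Lemma lattice_closure_riesz D :
  submod_closed (mem D) -> riesz_subspace (lattice_closure D).
Proof.
move=> /submod_closedP[D0 DD DZ].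
have LN x : lattice_closure D x -> lattice_closure D (- x).
  elim=> [y Dy|y z _ Ly _ Lz|y z _ Ly _ Lz].
  - by apply: lattice_closure_in; rewrite -scaleN1r; exact: DZ.
  - by rewrite riesz_oppI; exact: lattice_closureU.
  - by rewrite riesz_oppU; exact: lattice_closureI.
have LZ k x : 0 < k -> lattice_closure D x -> lattice_closure D (k *: x).
  move=> k0; elim=> [y Dy|y z _ Ly _ Lz|y z _ Ly _ Lz].
  - by apply: lattice_closure_in; exact: DZ.
  - by rewrite riesz_scaleI //; exact: lattice_closureI.
  - by rewrite riesz_scaleU //; exact: lattice_closureU.
split; last by move=> x y Lx Ly; split;
  [exact: lattice_closureI|exact: lattice_closureU].
apply/submod_closedP; split; first exact: lattice_closure_in.
- move=> x y Lx Ly; elim: Lx => [a Da|a b _ La _ Lb|a b _ La _ Lb].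
  + elim: Ly => [c Dc|c d _ Lc _ Ld|c d _ Lc _ Ld].
    * by apply: lattice_closure_in; exact: DD.
    * by rewrite addrC riesz_meetDl ![_ + a]addrC; exact: lattice_closureI.
    * by rewrite addrC riesz_joinDl ![_ + a]addrC; exact: lattice_closureU.
  + by rewrite riesz_meetDl; exact: lattice_closureI.
  + by rewrite riesz_joinDl; exact: lattice_closureU.
- move=> k x Lx; have [k0|k0|->] := ltgtP k 0; last 2 first.
  + exact: LZ.
  + by rewrite scale0r; exact: lattice_closure_in.
  by rewrite -[k]opprK scaleNr; apply: LN; apply: LZ; rewrite
    ?Num.Theory.oppr_gt0.
Qed.

Lemma riesz_generatedE D :
  submod_closed (mem D) -> riesz_generated D = lattice_closure D.
Proof.
move=> Dsub; apply/seteqP; split=> x.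
  apply; split; first exact: lattice_closure_riesz.
  by move=> y; exact: lattice_closure_in.
move=> Lx E [[_ EL] DE]; elim: Lx => [y /DE//|y z _ Ey _ Ez|y z _ Ey _ Ez].
  by have [] := EL _ _ Ey Ez.
by have [] := EL _ _ Ey Ez.
Qed.

End RieszSpace.

(** * Multiplication and disjointness in f-algebras *)

Section FAlgebra.
Variables (R : realType) (A : fAlgebraType R).
Implicit Types (f g h x y : A).

Lemma lalg_mulNl x y : ((- x)%R * y)%g = - (x * y)%g.
Proof. by rewrite -scaleN1r lalg_scaleAl scaleN1r. Qed.

Lemma lalg_mulNr x y : (x * (- y)%R)%g = - (x * y)%g.
Proof. by rewrite -scaleN1r lalg_scaleAr scaleN1r. Qed.

Lemma lalg_mulBl x y z : ((x - y)%R * z)%g = (x * z)%g - (y * z)%g.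
Proof. by rewrite lalg_mulDl lalg_mulNl. Qed.

Lemma lalg_mulBr x y z : (x * (y - z)%R)%g = (x * y)%g - (x * z)%g.
Proof. by rewrite lalg_mulDr lalg_mulNr. Qed.

Lemma falg_disjointMl f g h :
  0 <= h -> (f `&` g)%O = 0 -> ((h * f)%g `&` g)%O = 0.
Proof. by move=> h0 fg; have [] := falg_meet0 _ _ _ fg h0. Qed.

Lemma falg_disjointMr f g h :
  0 <= h -> (f `&` g)%O = 0 -> ((f * h)%g `&` g)%O = 0.
Proof. by move=> h0 fg; have [] := falg_meet0 _ _ _ fg h0. Qed.

Lemma falg_disjointM2l f g h k : 0 <= h -> 0 <= k ->
  (f `&` g)%O = 0 -> ((h * f)%g `&` (k * g)%g)%O = 0.
Proof.
by move=> h0 k0 fg; apply: falg_disjointMl => //; rewrite meetC;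
  apply: falg_disjointMl => //; rewrite meetC.
Qed.

Lemma falg_disjointM2r f g h k : 0 <= h -> 0 <= k ->
  (f `&` g)%O = 0 -> ((f * h)%g `&` (g * k)%g)%O = 0.
Proof.
by move=> h0 k0 fg; apply: falg_disjointMr => //; rewrite meetC;
  apply: falg_disjointMr => //; rewrite meetC.
Qed.

(** Two uses of the f-algebra condition make [f * g] disjoint from itself. *)
Lemma falg_disjoint_mul0 f g : (f `&` g)%O = 0 -> (f * g)%g = 0.
Proof.
move=> fg; have f0 : 0 <= f by rewrite -fg leIl.
have g0 : 0 <= g by rewrite -fg leIr.
rewrite -(meetxx (f * g)%g); apply: falg_disjointMr => //.
by rewrite meetC; apply: falg_disjointMl => //; rewrite meetC.
Qed.

(** Subtracting the meet from [f] and from [g] leaves disjoint elements. They stay disjoint after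
    multiplication by [h], and translating back gives the identity. *)
Lemma falg_mulIr h f g : 0 <= h ->
  (h * (f `&` g)%O)%g = ((h * f)%g `&` (h * g)%g)%O.
Proof.
move=> h0; have := falg_disjointM2l h0 h0 (riesz_disjoint_subI f g).
by rewrite !lalg_mulBr -riesz_meetDl => /subr0_eq.
Qed.

Lemma falg_mulIl h f g : 0 <= h ->
  ((f `&` g)%O * h)%g = ((f * h)%g `&` (g * h)%g)%O.
Proof.
move=> h0; have := falg_disjointM2r h0 h0 (riesz_disjoint_subI f g).
by rewrite !lalg_mulBl -riesz_meetDl => /subr0_eq.
Qed.

Lemma falg_mulUr h f g : 0 <= h ->
  (h * (f `|` g)%O)%g = ((h * f)%g `|` (h * g)%g)%O.
Proof.
move=> h0; rewrite -[(f `|` g)%O]opprK riesz_oppU lalg_mulNr falg_mulIr //.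
by rewrite riesz_oppI !lalg_mulNr !opprK.
Qed.

Lemma falg_mulUl h f g : 0 <= h ->
  ((f `|` g)%O * h)%g = ((f * h)%g `|` (g * h)%g)%O.
Proof.
move=> h0; rewrite -[(f `|` g)%O]opprK riesz_oppU lalg_mulNl falg_mulIl //.
by rewrite riesz_oppI !lalg_mulNl !opprK.
Qed.

(* The negative part of [y - x y + x^2 y] lies below both [(x y - y)^+] and
   [x (x y - y)^-], which are disjoint. *)
Lemma falg_mul_le_sqr x y : 0 <= x -> 0 <= y ->
  (x * y)%g <= y + (x * (x * y))%g.
Proof.
move=> x0 y0; set w := (x * y)%g; set u := w - y.
set d := (u `|` 0)%O; set e := ((- u) `|` 0)%O.
have w0 : 0 <= w by exact: lalg_mul_ge0.
have xw0 : 0 <= (x * w)%g by exact: lalg_mul_ge0.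
have xd0 : 0 <= (x * d)%g by apply: lalg_mul_ge0; rewrite // leUr.
(* As [w] is [x * y], the left side is [x * u], and [u = d - e]. *)
have xu : (x * w)%g - w = (x * d)%g - (x * e)%g.
  by rewrite -lalg_mulBr -riesz_posE lalg_mulBr.
have de : (d `&` (x * e)%g)%O = 0.
  by rewrite meetC; apply: falg_disjointMl => //; rewrite meetC
    riesz_pos_disjoint.
rewrite -riesz_subr_ge0 -riesz_leN2 oppr0 -de lexI; apply/andP; split.
  apply: le_trans (leUl _ _); rewrite !opprD opprK addrC addrA.
  by rewrite riesz_leBlDr riesz_leDl.
rewrite -addrA xu addrA opprB -/e riesz_leBlDr.
by apply: riesz_leDl; exact: riesz_addr_ge0.
Qed.

(** The positive part of [x * y] is [a * b + a' * b'], with the unwanted term [a' * b']. The second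
    argument of the meet removes it: its positive part [F b] dominates [a * b] and is disjoint from
    [a' * b']. *)
Lemma falg_pos_mul x y :
  ((x `|` 0)%O * (y `|` 0)%O)%g =
  (((x * y)%g `&` (y + (x * (x * y))%g)) `|` 0)%O.
Proof.
set a := (x `|` 0)%O; set b := (y `|` 0)%O.
pose a' := ((- x) `|` 0)%O; pose b' := ((- y) `|` 0)%O.
have aa' : (a `&` a')%O = 0 by exact: riesz_pos_disjoint.
have bb' : (b `&` b')%O = 0 by exact: riesz_pos_disjoint.
have xE : x = a - a' by exact: riesz_posE.
have yE : y = b - b' by exact: riesz_posE.
have [a0 a'0 b0 b'0] : [/\ 0 <= a, 0 <= a', 0 <= b & 0 <= b'].
  by split; exact: leUr.
have a'a : (a' `&` a)%O = 0 by rewrite meetC.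
have b'b : (b' `&` b)%O = 0 by rewrite meetC.
have xyE : (x * y)%g = ((a * b)%g + (a' * b')%g) - ((a * b')%g + (a' * b)%g).
  rewrite xE yE lalg_mulBl !lalg_mulBr !opprD opprK -!addrA; congr (_ + _).
  by rewrite addrA addrC.
(* The cross terms vanish because [a] and [a'] are disjoint, so [z] is multiplied by a sum of
   squares of positive elements; hence [F] preserves disjointness. *)
have xxE z : (x * (x * z))%g = (a * (a * z))%g + (a' * (a' * z))%g.
  rewrite xE [((a - a')%R * z)%g]lalg_mulBl lalg_mulBr !lalg_mulBl.
  have mul0 u v : (u * v)%g = 0 -> (u * (v * z))%g = 0.
    by move=> uv; rewrite mulgA uv -[in LHS](scale0r z) lalg_scaleAl scale0r.
  by rewrite (mul0 _ _ (falg_disjoint_mul0 aa'))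
    (mul0 _ _ (falg_disjoint_mul0 a'a))
    subr0 sub0r opprK.
pose F z := z + (x * (x * z))%g.
have FB : y + (x * (x * y))%g = F b - F b'.
  by rewrite yE /F !lalg_mulBr opprD addrACA.
have Fdisj u v : (u `&` v)%O = 0 -> (F u `&` v)%O = 0.
  move=> uv; rewrite /F xxE.
  by do ![apply: riesz_disjointD | apply: falg_disjointMl].
have FbFb' : (F b `&` F b')%O = 0.
  by apply: (Fdisj); rewrite meetC; apply: Fdisj.
have abF : (a * b)%g <= F b.
  apply: (le_trans (falg_mul_le_sqr a0 b0)); rewrite /F xxE.
  by apply: riesz_leD => //; apply: riesz_leDl; do !apply: lalg_mul_ge0.
have a'b'F : (a' * b')%g <= F b'.
  apply: (le_trans (falg_mul_le_sqr a'0 b'0)); rewrite /F xxE.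
  by apply: riesz_leD => //; apply: riesz_leDr; do !apply: lalg_mul_ge0.
have ab_a'b' : ((a * b)%g `&` (a' * b')%g)%O = 0 by exact: falg_disjointM2r.
have a'b'Fb : ((a' * b')%g `&` F b)%O = 0.
  by apply: (riesz_disjointW _ a'b'F); rewrite 1?meetC //; exact: lalg_mul_ge0.
(* Each of the four pairs of products agrees in one factor and has disjoint elements in the
   other. *)
have pq_disjoint : (((a * b)%g + (a' * b')%g) `&` ((a * b')%g + (a' * b)%g))%O
  = 0.
  by apply: riesz_disjointD; rewrite meetC; apply: riesz_disjointD;
    solve [exact: falg_disjointM2l | exact: falg_disjointM2r].
(* Both arguments of the meet are now differences of disjoint elements, so their positive parts can
   be read off; the disjoint sum [a * b + a' * b'] is then a join, over which the meet with [F b]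
   distributes. *)
rewrite FB xyE riesz_joinIl !riesz_posB // -riesz_meet_join ab_a'b' add0r.
rewrite riesz_meetUl a'b'Fb (meet_idPl abF); apply/esym/join_idPl.
exact: lalg_mul_ge0.
Qed.

End FAlgebra.

Theorem theorem3p3 (R : realType) (A : fAlgebraType R) (B : set A) :
  archimedean_riesz A -> semiprime A -> subalgebra B ->
  f_subalgebra (riesz_generated B).
Proof.
move=> _ _ [Bsub Bmul]; rewrite riesz_generatedE //.
have [Lsub LUI] := lattice_closure_riesz Bsub; split=> //; split=> //.
have /submod_closedP[B0 BD _] := Bsub.
have /submod_closedP[L0 LD LZ] := Lsub.
have BM x y : B x -> B y -> B (x * y)%g.
  by move=> Bx By; have := Bmul x y; rewrite !inE; apply.
have LI x y Lx Ly := (LUI x y Lx Ly).1.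
have LU x y Lx Ly := (LUI x y Lx Ly).2.
have LN x : lattice_closure B x -> lattice_closure B (- x).
  by rewrite -scaleN1r; exact: LZ.
have pos_ge0 (x : A) : 0 <= (x `|` 0)%O by exact: leUr.
(* Double induction on lattice polynomials: taking positive parts, and multiplying by a fixed
   positive element, both commute with meets and joins. *)
have Lpos x y : lattice_closure B x -> lattice_closure B y ->
    lattice_closure B ((x `|` 0)%O * (y `|` 0)%O)%g.
  have pos_join (u v : A) : (u `|` v `|` 0)%O = ((u `|` 0) `|` (v `|` 0))%O.
    by rewrite joinACA joinxx.
  elim=> [{}x Bx|u v _ IHu _ IHv|u v _ IHu _ IHv] Ly.
  - elim: Ly => [{}y By|u v _ IHu _ IHv|u v _ IHu _ IHv].
    (* At the leaves, [x * y] and [y + x * (x * y)] lie in [B] because it is a subalgebra. *)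
    + rewrite falg_pos_mul; apply: LU; last exact: L0.
      by apply: lattice_closureI; apply: lattice_closure_in; auto.
    + by rewrite riesz_joinIl falg_mulIr //; exact: LI.
    + by rewrite pos_join falg_mulUr //; exact: LU.
  - by rewrite riesz_joinIl falg_mulIl //; apply: LI; auto.
  - by rewrite pos_join falg_mulUl //; apply: LU; auto.
move=> x y; rewrite !inE => Lx Ly.
(* The product expands into four signed products of positive parts of [x], [- x], [y] and [- y]. *)
rewrite [x]riesz_posE [y]riesz_posE lalg_mulBl !lalg_mulBr.
by do ![apply: (LD) | apply: (LN) | apply: (Lpos)].
Qed.
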